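(* The following eight mesh patterns $(12,R)$ are pairwise equidistributed, where $R$ ranges over: $\{(0,2),(1,2),(2,2),(2,1),(0,0),(1,0)\}$, $\{(0,2),(2,2),(0,1),(2,1),(0,0),(1,0)\}$, $\{(1,2),(2,2),(0,1),(2,1),(0,0),(2,0)\}$, $\{(1,2),(2,2),(0,1),(0,0),(1,0),(2,0)\}$, $\{(0,2),(1,2),(2,2),(0,1),(1,1),(2,0)\}$, $\{(0,2),(1,2),(0,1),(1,1),(0,0),(2,0)\}$, $\{(0,2),(2,2),(1,1),(2,1),(1,0),(2,0)\}$, $\{(0,2),(1,1),(2,1),(0,0),(1,0),(2,0)\}$. Moreover, for each such pattern $p$ and $n\ge1$, $$\sum_{\pi\in S_n}q^{p(\pi)}=n!-\sum_{i=0}^{n-2}i!(n-i-1)!+q\sum_{i=0}^{n-2}i!(n-i-1)!.$$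
   Context: For $R\subseteq\{0,1,2\}^2$ and $\pi=\pi_1\cdots\pi_n\in S_n$, an occurrence of the mesh pattern $(12,R)$ in $\pi$ is a pair of positions $i_1<i_2$ with $\pi_{i_1}<\pi_{i_2}$ such that, setting $x_0=0,x_1=i_1,x_2=i_2,x_3=n+1$ and $y_0=0,y_1=\pi_{i_1},y_2=\pi_{i_2},y_3=n+1$, for every $(a,b)\in R$ there is no index $k$ with $x_a<k<x_{a+1}$ and $y_b<\pi_k<y_{b+1}$. $p(\pi)$ is the number of occurrences of $p$ in $\pi$; $s_{n,k}(p)$ the number of $\pi\in S_n$ with $p(\pi)=k$; $p_1,p_2$ are equidistributed if $s_{n,k}(p_1)=s_{n,k}(p_2)$ for all $n,k\ge 0$. *)

(* Defs.v *)
From mathcomp Require Import all_boot all_order all_algebra all_fingroup.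

Set Implicit Arguments.
Unset Strict Implicit.
Unset Printing Implicit Defensive.

(* A box (a, b) is given by its column a and its row b, both counted from the
   bottom left corner. *)
Definition box (a b : nat) : 'I_3 * 'I_3 := (inord a, inord b).

(* [k : 'I_n] stands for the 1-based position [k.+1], and the 1-based value
   of the permutation [s] at that position is [(s k).+1]. *)
Definition mesh12_occ (R : {set 'I_3 * 'I_3}) (n : nat) (s : 'S_n)
    (i j : 'I_n) : bool :=
  let x := [:: 0; i.+1; j.+1; n.+1] in
  let y := [:: 0; (s i).+1; (s j).+1; n.+1] in
  [&& i < j, s i < s j &
    [forall c in R, ~~ [exists k : 'I_n,
      (nth 0 x c.1 < k.+1 < nth 0 x c.1.+1) &&
      (nth 0 y c.2 < (s k).+1 < nth 0 y c.2.+1)]]].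

Definition mesh12_count (R : {set 'I_3 * 'I_3}) (n : nat) (s : 'S_n) : nat :=
  #|[set ij : 'I_n * 'I_n | mesh12_occ R s ij.1 ij.2]|.

Definition mesh12_dist (R : {set 'I_3 * 'I_3}) (n k : nat) : nat :=
  #|[set s : 'S_n | mesh12_count R s == k]|.

Definition equidistributed (R1 R2 : {set 'I_3 * 'I_3}) : Prop :=
  forall n k : nat, mesh12_dist R1 n k = mesh12_dist R2 n k.

Definition shadings : seq {set 'I_3 * 'I_3} :=
  [:: [set box 0 2; box 1 2; box 2 2; box 2 1; box 0 0; box 1 0];
      [set box 0 2; box 2 2; box 0 1; box 2 1; box 0 0; box 1 0];
      [set box 1 2; box 2 2; box 0 1; box 2 1; box 0 0; box 2 0];
      [set box 1 2; box 2 2; box 0 1; box 0 0; box 1 0; box 2 0];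
      [set box 0 2; box 1 2; box 2 2; box 0 1; box 1 1; box 2 0];
      [set box 0 2; box 1 2; box 0 1; box 1 1; box 0 0; box 2 0];
      [set box 0 2; box 2 2; box 1 1; box 2 1; box 1 0; box 2 0];
      [set box 0 2; box 1 1; box 2 1; box 0 0; box 1 0; box 2 0]].

(* Main.v *)
(** Transposition (inversion of permutations), reverse-complement, and the
    reversal of all values below the maximum are bijections of S_n that carry
    the eight patterns to the first one. An occurrence of the first pattern
    says that the maximum of pi, at a 0-based position j > 0, separates a nonempty
    prefix from a suffix all of whose values are smaller, the other point of
    the occurrence being the minimum of the prefix; so there is at most one
    occurrence. The permutations with an occurrence and maximum at j form a
    coset of the product of the symmetric groups on the j positions before it
    and the n - 1 - j positions after it. *)
Require Import Defs.
From mathcomp Require Import all_boot all_order all_algebra all_fingroup.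
From mathcomp Require Import zify.
Import GRing.Theory.

(** * Permutations with a prescribed image of a set and of a point *)

Lemma exists_perm_imset (T : finType) (A V : {set T}) (c d : T) :
    c \notin A -> d \notin V -> #|A| = #|V| ->
  exists t : {perm T}, t @: A = V /\ t c = d.
Proof.
move=> cA dV eqAV.
(* List [A], then [c], then all other elements, and likewise [V], [d] and the rest; the permutation
   matches the two lists place by place. As [#|A| = #|V|], the blocks line up. *)
pose l (X : {set T}) x := enum X ++ x :: enum (~: (x |: X)).
have lU (X : {set T}) x : x \notin X -> uniq (l X x).
  move=> xX; rewrite /l cat_uniq /= !enum_uniq !mem_enum !inE eqxx /= andbT.
  rewrite (negPf xX) /=; apply/hasPn => y.
  by rewrite !mem_enum !inE negb_or => /andP[_].
have lA (X : {set T}) x y : y \in l X x.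
  by rewrite mem_cat inE !mem_enum !inE; case: (y \in X); case: (y == x).
have lS (X : {set T}) x : x \notin X -> size (l X x) = #|T|.
  move=> xX; rewrite -(card_uniqP (lU X x xX)).
  by apply: eq_card => y; rewrite lA.
pose f x := nth d (l V d) (index x (l A c)).
have ltf x : index x (l A c) < size (l V d).
  by rewrite (lS V) // -(lS A c) // index_mem lA.
have f_inj : injective f.
  move=> x y /eqP; rewrite nth_uniq ?lU // => /eqP eqi.
  by rewrite -(nth_index c (lA A c x)) eqi nth_index ?lA.
exists (perm f_inj); split.
  apply/eqP; rewrite eqEcard card_imset; last exact: perm_inj.
  rewrite eqAV leqnn andbT; apply/subsetP => _ /imsetP[x xA ->].
  have ltV : index x (enum A) < size (enum V).
    by rewrite -cardE -eqAV cardE index_mem mem_enum.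
  by rewrite permE /f /l index_cat mem_enum xA nth_cat ltV -mem_enum mem_nth.
rewrite permE /f /l index_cat mem_enum (negPf cA) /= eqxx addn0 nth_cat.
by rewrite -!cardE eqAV ltnn subnn.
Qed.

(** Fix one such permutation [t]. The others are those [s] for which [s * t^-1] stabilises [A] and
    fixes [c], hence also stabilises the complement [B] of [c |: A]. So they form a right coset of
    the direct product of [Sym A] and [Sym B]. *)
Lemma card_perm_imset (T : finType) (A V : {set T}) (c d : T) :
    c \notin A -> d \notin V -> #|A| = #|V| ->
  #|[set s : {perm T} | (s @: A == V) && (s c == d)]|
    = #|A|`! * (#|T| - #|A|).-1`!.
Proof.
move=> cA dV eqAV; have [t [tA tc]] := exists_perm_imset _ _ _ _ _ cA dV eqAV.
pose B := ~: (c |: A).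
have cB : c \notin B by rewrite !inE eqxx.
have disAB : [disjoint A & B].
  by rewrite disjoint_sym disjoints_subset setCS subsetUr.
have cardB : #|B| = (#|T| - #|A|).-1.
  by have := cardsC (c |: A); rewrite -/B cardsU1 cA; lia.
have TI : Sym A :&: Sym B = 1%g.
  apply/trivgP/subsetP => u; rewrite !inE => /andP[uA uB].
  apply/eqP/permP => x; rewrite perm1.
  have [xA|xA] := boolP (x \in A); last by rewrite (out_perm uA).
  by rewrite (out_perm uB) // (disjointFr disAB).
suff -> : [set s : {perm T} | (s @: A == V) && (s c == d)]
    = ((Sym A * Sym B) :* t)%g.
  by rewrite card_rcoset TI_cardMg // !card_Sym cardB.
apply/setP => s; rewrite mem_rcoset inE; apply/andP/mulsgP.
  case=> /eqP sA /eqP sc; set u := (s * t^-1)%g.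
  have uA x : (u x \in A) = (x \in A).
    rewrite permM -[LHS](mem_imset _ _ (@perm_inj _ t)) permKV tA -sA.
    exact/mem_imset/perm_inj.
  have uc : u c = c by rewrite permM sc -tc permK.
  have uB x : (u x \in B) = (x \in B).
    by rewrite !inE uA -[X in u x == X]uc (inj_eq perm_inj).
  have uN (X : {set T}) :
      (forall x, (u x \in X) = (x \in X)) -> u \in ('N(X | 'P))%g.
    by move=> uX; apply/astabsP => x; apply: uX.
  exists (restr_perm A u) (restr_perm B u); rewrite ?inE ?restr_perm_on //.
  apply/permP => x; rewrite [RHS]permM.
  have [xA|xA] := boolP (x \in A).
    have uxA : u x \in A by rewrite uA.
    rewrite (restr_permE (uN A uA) xA) (out_perm (restr_perm_on B u)) //.
    by rewrite (disjointFr disAB).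
  rewrite (out_perm (restr_perm_on A u)) //.
  have [xB|xB] := boolP (x \in B); first by rewrite (restr_permE (uN B uB) xB).
  rewrite (out_perm (restr_perm_on B u)) //.
  by move: xB; rewrite !inE negbK (negPf xA) orbF => /eqP->.
case=> a b; rewrite !inE => aA bB /(canRL (mulgK _)); rewrite invgK => ->.
split; apply/eqP.
  rewrite -tA; apply/setP=> y; apply/imsetP/imsetP=> -[x xA ->].
    exists (a x); first by rewrite (perm_closed _ aA).
    by rewrite !permM (out_perm bB) // (disjointFr disAB) // (perm_closed _ aA).
  exists ((a^-1)%g x); first by rewrite perm_closed // perm_onV.
  by rewrite !permM permKV (out_perm bB) // (disjointFr disAB).
by rewrite !permM (out_perm aA) // (out_perm bB).
Qed.

(** * Mesh occurrences and the symmetries of the square *)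

Lemma eq_box (c : 'I_3 * 'I_3) (a b : nat) : a < 3 -> b < 3 ->
  (c == box a b) = (c.1 == a :> nat) && (c.2 == b :> nat).
Proof.
by move=> lta ltb; rewrite -pair_eqE /= -!val_eqE /= !inordK.
Qed.

Lemma mesh12_occP (R : {set 'I_3 * 'I_3}) n (s : 'S_n) (i j : 'I_n) :
  let x := [:: 0; i.+1; j.+1; n.+1] in
  let y := [:: 0; (s i).+1; (s j).+1; n.+1] in
  reflect [/\ i < j, s i < s j & forall c, c \in R -> forall k : 'I_n,
    ~~ ((nth 0 x c.1 < k.+1 < nth 0 x c.1.+1) &&
      (nth 0 y c.2 < (s k).+1 < nth 0 y c.2.+1))] (mesh12_occ R s i j).
Proof.
move=> x y; apply: (iffP and3P) => -[ltij lts occ]; split=> //.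
  by move=> c cR k; have /forall_inP/(_ c cR)/existsPn := occ; apply.
by apply/forall_inP => c cR; apply/existsPn => k; apply: occ.
Qed.

Lemma mesh12_occ_box (R : {set 'I_3 * 'I_3}) n (s : 'S_n) (i j : 'I_n) a b :
    a < 3 -> b < 3 -> box a b \in R -> mesh12_occ R s i j ->
  let x := [:: 0; i.+1; j.+1; n.+1] in
  let y := [:: 0; (s i).+1; (s j).+1; n.+1] in
  forall k : 'I_n, ~~ ((nth 0 x a < k.+1 < nth 0 x a.+1) &&
      (nth 0 y b < (s k).+1 < nth 0 y b.+1)).
Proof.
move=> lta ltb abR /mesh12_occP[_ _ /(_ _ abR)] occ x y k.
by have:= occ k; rewrite /= !inordK.
Qed.

Lemma mesh12_count_bij (R R' : {set 'I_3 * 'I_3}) n (s s' : 'S_n)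
    (f : 'I_n * 'I_n -> 'I_n * 'I_n) : bijective f ->
  (forall p, mesh12_occ R' s' (f p).1 (f p).2 = mesh12_occ R s p.1 p.2) ->
  mesh12_count R' s' = mesh12_count R s.
Proof.
move=> f_bij eq_occ; rewrite /mesh12_count.
rewrite -(on_card_preimset (f := f)); last by apply: onW_bij.
by apply: eq_card => p; rewrite !inE.
Qed.

Lemma mesh12_dist_inj (R R' : {set 'I_3 * 'I_3}) n (g : 'S_n -> 'S_n) :
    injective g -> (forall s, mesh12_count R' (g s) = mesh12_count R s) ->
  forall k, mesh12_dist R' n k = mesh12_dist R n k.
Proof.
move=> g_inj eq_count k; rewrite /mesh12_dist.
rewrite -(on_card_preimset (f := g)); last by apply/onW_bij/injF_bij.
by apply: eq_card => s; rewrite !inE eq_count.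
Qed.

(** Inversion reflects the diagram of a permutation in its diagonal: the points at [i] and [j] move
    to positions [s i] and [s j], and columns become rows. *)
Lemma mesh12_dist_transpose (R R' : {set 'I_3 * 'I_3}) :
    (forall c, (c \in R') = ((c.2, c.1) \in R)) ->
  equidistributed R' R.
Proof.
move=> RR' n; apply: (@mesh12_dist_inj _ _ n (fun s => (s^-1)%g)).
  exact: invg_inj.
move=> s; apply: (@mesh12_count_bij _ _ _ _ _ (fun p => (s p.1, s p.2))).
  by exists (fun p => ((s^-1)%g p.1, (s^-1)%g p.2)) => -[i j] /=;
    rewrite ?permK ?permKV.
move=> [i j] /=; apply/mesh12_occP/mesh12_occP; rewrite /= !permK.
  case=> lts lt occ; split=> // -[a b] abR k.
  by have := occ (b, a); rewrite RR' => /(_ abR (s k)); rewrite permK /= andbC.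
case=> lt lts occ; split=> // -[a b] abR k.
by move: abR; rewrite RR' => /occ/(_ ((s^-1)%g k)); rewrite permKV /= andbC.
Qed.

Lemma mesh12_dist_revcompl (R R' : {set 'I_3 * 'I_3}) :
    (forall c, (c \in R') = ((rev_ord c.1, rev_ord c.2) \in R)) ->
  equidistributed R' R.
Proof.
move=> RR' n; pose r : 'S_n := perm rev_ord_inj.
apply: (@mesh12_dist_inj _ _ n (fun s => (r * s * r)%g)).
  by move=> s t /mulIg/mulgI.
move=> s.
(* The half turn reverses the order of the two points, so the pair is swapped as well. *)
apply: (@mesh12_count_bij _ _ _ _ _ (fun p => (rev_ord p.2, rev_ord p.1))).
  by exists (fun p => (rev_ord p.2, rev_ord p.1)) => -[i j] /=;
    rewrite !rev_ordK.
have rsr k : (r * s * r)%g (rev_ord k) = rev_ord (s k).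
  by rewrite !permM !permE rev_ordK.
(* Stated for arbitrary [i], [j], [k], this serves for columns and, applied to values of [s], for
   rows. *)
have flip (c : 'I_3) (i j k : 'I_n) :
   (nth 0 [:: 0; (rev_ord j).+1; (rev_ord i).+1; n.+1] c < (rev_ord k).+1
      < nth 0 [:: 0; (rev_ord j).+1; (rev_ord i).+1; n.+1] c.+1)
   = (nth 0 [:: 0; i.+1; j.+1; n.+1] (rev_ord c) < k.+1
      < nth 0 [:: 0; i.+1; j.+1; n.+1] (rev_ord c).+1).
  have := ltn_ord i; have := ltn_ord j; have := ltn_ord k.
  by case: c => -[|[|[|c]]] // c3; rewrite /=; lia.
have flip_lt (i j : 'I_n) : (rev_ord j < rev_ord i) = (i < j).
  by have := ltn_ord i; have := ltn_ord j; rewrite /=; lia.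
move=> [i j] /=; apply/mesh12_occP/mesh12_occP; rewrite !rsr !flip_lt.
  case=> lt lts occ; split=> // c cR k.
  have := flip (rev_ord c.1) i j k.
  have := flip (rev_ord c.2) (s i) (s j) (s k).
  rewrite !rev_ordK => <- <-.
  have := occ (rev_ord c.1, rev_ord c.2) _ (rev_ord k); rewrite rsr; apply.
  by rewrite RR' !rev_ordK; case: c cR.
case=> lt lts occ; split=> // c; rewrite RR' => cR k.
by rewrite -(rev_ordK k) rsr !flip; apply: occ cR _.
Qed.

(** * Two representative patterns, with the maximum as upper point *)

Definition shading1 : {set 'I_3 * 'I_3} :=
  [set box 0 2; box 1 2; box 2 2; box 2 1; box 0 0; box 1 0].
Definition shading5 : {set 'I_3 * 'I_3} :=
  [set box 0 2; box 1 2; box 2 2; box 0 1; box 1 1; box 2 0].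

Lemma ord_perm_eqE n (s : 'S_n) (k l : 'I_n) :
  (s k == s l :> nat) = (k == l :> nat).
Proof. by rewrite !val_eqE (inj_eq perm_inj). Qed.

(** With the whole top row shaded no value exceeds [s j]; the position holding the value [n.-1] then
    shows that [s j] is the maximum. *)
Lemma mesh12_occ_top (R : {set 'I_3 * 'I_3}) n (s : 'S_n) (i j : 'I_n) :
    box 0 2 \in R -> box 1 2 \in R -> box 2 2 \in R -> mesh12_occ R s i j ->
  (s j).+1 = n.
Proof.
move=> R02 R12 R22 occ; have ltn := ltn_ord.
have [ltij lts _] := mesh12_occP _ _ _ _ _ occ.
have top (k : 'I_n) : s k <= s j.
  have := mesh12_occ_box _ _ _ _ _ 0 2 erefl erefl R02 occ k.
  have := mesh12_occ_box _ _ _ _ _ 1 2 erefl erefl R12 occ k.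
  have := mesh12_occ_box _ _ _ _ _ 2 2 erefl erefl R22 occ k.
  have := ord_perm_eqE n s k j; have := ord_perm_eqE n s k i.
  have := ltn _ k; have := ltn _ (s k); rewrite /=; lia.
have ltm : n.-1 < n by have := ltn _ i; lia.
have := top ((s^-1)%g (Ordinal ltm)); rewrite permKV /=.
by have := ltn _ (s j); lia.
Qed.

(** The top row makes [s j] the maximum. Boxes (0,0) and (1,0) keep the entries left of [j] from
    falling below [s i]; box (2,1) keeps those to the right from exceeding it. *)
Lemma shading1_occP n (s : 'S_n) (i j : 'I_n) :
  reflect [/\ i < j, (s j).+1 = n, forall k : 'I_n, k < j -> s i <= s k
           & forall k : 'I_n, j < k -> s k < s i]
   (mesh12_occ shading1 s i j).
Proof.
have ltn := ltn_ord; have sE := ord_perm_eqE n s; apply: (iffP idP).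
  move=> occ; have [ltij lts _] := mesh12_occP _ _ _ _ _ occ.
  have B a b lta ltb abR := mesh12_occ_box _ _ _ _ _ a b lta ltb abR occ.
  have sj : (s j).+1 = n.
    by apply: mesh12_occ_top occ; rewrite !inE eqxx ?orbT.
  have B21 := B 2 1 erefl erefl; have B00 := B 0 0 erefl erefl.
  have B10 := B 1 0 erefl erefl; move: B21 B00 B10; rewrite !inE !eqxx ?orbT /=.
  move=> /(_ isT) B21 /(_ isT) B00 /(_ isT) B10.
  split=> // k ltk; have := B21 k; have := B00 k; have := B10 k;
    have := sE k j; have := sE k i; have := ltn _ k; have := ltn _ (s k); lia.
case=> ltij sj left right; apply/mesh12_occP; split=> //.
  by have := sE i j; have := ltn _ (s i); lia.
move=> [[[|[|[|a]]] lta] [[|[|[|b]]] ltb]] //=; rewrite !inE !eq_box //= => _ k;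
  have := left k; have := right k; have := sE k j; have := sE k i;
  have := ltn _ k; have := ltn _ (s k); lia.
Qed.

Lemma shading5_occP n (s : 'S_n) (i j : 'I_n) :
  reflect [/\ i < j, (s j).+1 = n, forall k : 'I_n, k < j -> s k <= s i
           & forall k : 'I_n, j < k -> s i < s k]
   (mesh12_occ shading5 s i j).
Proof.
have ltn := ltn_ord; have sE := ord_perm_eqE n s; apply: (iffP idP).
  move=> occ; have [ltij lts _] := mesh12_occP _ _ _ _ _ occ.
  have B a b lta ltb abR := mesh12_occ_box _ _ _ _ _ a b lta ltb abR occ.
  have sj : (s j).+1 = n.
    by apply: mesh12_occ_top occ; rewrite !inE eqxx ?orbT.
  have B01 := B 0 1 erefl erefl; have B11 := B 1 1 erefl erefl.
  have B20 := B 2 0 erefl erefl; move: B01 B11 B20; rewrite !inE !eqxx ?orbT /=.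
  move=> /(_ isT) B01 /(_ isT) B11 /(_ isT) B20.
  split=> // k ltk; have := B01 k; have := B11 k; have := B20 k;
    have := sE k j; have := sE k i; have := ltn _ k; have := ltn _ (s k); lia.
case=> ltij sj left right; apply/mesh12_occP; split=> //.
  by have := sE i j; have := ltn _ (s i); lia.
move=> [[[|[|[|a]]] lta] [[|[|[|b]]] ltb]] //=; rewrite !inE !eq_box //= => _ k;
  have := left k; have := right k; have := sE k j; have := sE k i;
  have := ltn _ k; have := ltn _ (s k); lia.
Qed.

(* The value map [v |-> n - 2 - v] below the top value [n - 1] exchanges the
   two conditions "left of the maximum lies above right" and "below right". *)
Lemma equidistributed_shading5_shading1 : equidistributed shading5 shading1.
Proof.
(* Below the top value the difference is not truncated and stays below [n], so the default of
   [insubd] is never returned. *)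
move=> n; pose f (v : 'I_n) := if v.+1 == n then v else insubd v (n.-2 - v).
have fE v : f v = (if v.+1 == n then v : nat else n.-2 - v) :> nat.
  rewrite /f; case: eqP => // vn; rewrite val_insubd ifT //.
  by have := ltn_ord v; lia.
have f_inj : injective f.
  move=> v w /(congr1 val) /=; rewrite !fE => eqf; apply/val_inj => /=.
  have := ltn_ord v; have := ltn_ord w; move: eqf.
  by do 2!case: eqP; lia.
apply: (@mesh12_dist_inj _ _ n (fun s => s * perm f_inj)%g).
  by move=> s t /mulIg.
move=> s.
apply: (@mesh12_count_bij _ _ _ _ _ id); first by exists id.
move=> [i j] /=; have ltn := ltn_ord; have sE := ord_perm_eqE n s.
apply/shading5_occP/shading1_occP; rewrite !permM !permE !fE;
  move=> -[ltij sj left right].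
  have {}sj : (s j).+1 = n by move: sj; have := ltn _ (s j); case: eqP; lia.
  have si : (s i).+1 == n = false by have := sE i j; lia.
  split=> // k ltk; have := left k; have := right k; rewrite permM permE !fE si;
  have := sE k j; have := ltn _ k; have := ltn _ (s k); have := ltn _ (s i);
  case: ((s k).+1 =P n); lia.
have si : (s i).+1 == n = false by have := sE i j; lia.
split=> //; first by rewrite sj eqxx.
all: move=> k ltk; have := left k; have := right k; rewrite permM permE !fE si;
  have := sE k j; have := ltn _ k; have := ltn _ (s k); have := ltn _ (s i);
  case: ((s k).+1 =P n); lia.
Qed.

Ltac check_boxes :=
  case=> [[[|[|[|?]]] ?] [[|[|[|?]]] ?]] //=; by rewrite !inE !eq_box.

(** The first four patterns form one orbit under transposition and reverse-complement, the last four
    another one, that of [shading5]. The second and the sixth pattern need both symmetries in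
    turn. *)
Lemma shadings_equidistributed (R : {set 'I_3 * 'I_3}) :
  R \in shadings -> equidistributed R shading1.
Proof.
have trans Q S : equidistributed S Q -> equidistributed Q shading1 ->
  equidistributed S shading1 by move=> SQ Q1 n k; rewrite SQ Q1.
have E5 := equidistributed_shading5_shading1.
rewrite !inE => /or4P[/eqP->|/eqP->|/eqP->|].
- by [].
- apply: (trans [set box 1 2; box 2 2; box 0 1; box 0 0; box 1 0; box 2 0]).
    by apply: mesh12_dist_transpose; check_boxes.
  by apply: mesh12_dist_revcompl; check_boxes.
- by apply: mesh12_dist_transpose; check_boxes.
case/or4P=> [/eqP->|/eqP->|/eqP->|/orP[]/eqP->].
- by apply: mesh12_dist_revcompl; check_boxes.
- by [].
- apply: (trans [set box 0 2; box 1 1; box 2 1; box 0 0; box 1 0; box 2 0]).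
    by apply: mesh12_dist_transpose; check_boxes.
  by apply: (trans shading5) => //; apply: mesh12_dist_revcompl; check_boxes.
- by apply: (trans shading5) => //; apply: mesh12_dist_transpose; check_boxes.
by apply: (trans shading5) => //; apply: mesh12_dist_revcompl; check_boxes.
Qed.

(** * Counting permutations with an occurrence of the first pattern *)

Lemma card_ord_itv n (a b : nat) : b <= n ->
  #|[set v : 'I_n | a <= v < b]| = b - a.
Proof.
move=> leb; rewrite -[RHS]muln1 -(sum_nat_const_nat a b 1).
rewrite (big_nat_widen a b n) // (big_nat_widenl a 0) // big_mkord sum1dep_card.
by apply: eq_card => v; rewrite !inE andbC.
Qed.

(** Phrased through the image of a set and of a point, to match [card_perm_imset]; the trivial bound
    [0 <= k] gives the prefix the shape of [card_ord_itv]. *)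
Definition splits_at m (s : 'S_m.+1) (j : 'I_m.+1) :=
  (s @: [set k : 'I_m.+1 | 0 <= k < j] == [set v : 'I_m.+1 | m - j <= v < m])
  && (s j == ord_max).

Lemma splits_atP m (s : 'S_m.+1) (j : 'I_m.+1) :
  reflect [/\ s j = m :> nat, forall k : 'I_m.+1, k < j -> m - j <= s k
            & forall k : 'I_m.+1, j < k -> s k < m - j] (splits_at m s j).
Proof.
have ltn := ltn_ord; have sE := ord_perm_eqE m.+1 s.
have mem_s (X : {set 'I_m.+1}) k : (s k \in s @: X) = (k \in X).
  exact/mem_imset/perm_inj.
apply: (iffP andP) => [[/eqP sA /eqP sj]|[sj left right]].
  split=> [|k|k]; first by rewrite sj.
    by have := mem_s [set k : 'I_m.+1 | 0 <= k < j] k; rewrite sA !inE; lia.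
  have := mem_s [set k : 'I_m.+1 | 0 <= k < j] k; rewrite sA !inE.
  by have := sE k j; rewrite sj /=; have := ltn _ (s k); lia.
split; last by apply/eqP/val_inj.
have [ltj lej] := (ltn _ j, ltnW (ltn _ j)).
rewrite eqEcard (card_imset _ (@perm_inj _ s)) !card_ord_itv //.
apply/andP; split; last by lia.
apply/subsetP => _ /imsetP[k kj ->]; move: kj; rewrite !inE => ltkj.
by have := left k; have := sE k j; have := ltn _ (s k); lia.
Qed.

(** Pigeonhole on both sides: the [m - j] entries right of [j] have values below [s i], so
    [m - j <= s i]; the [j] entries to the left have values from [s i] up to [m - 1], so
    [s i <= m - j]. *)
Lemma shading1_occ_splits m (s : 'S_m.+1) (i j : 'I_m.+1) :
  mesh12_occ shading1 s i j -> splits_at m s j.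
Proof.
case/shading1_occP => ltij [sj] left right; apply/splits_atP; split=> // k ltk.
  apply: leq_trans (left k ltk).
  have <- : #|s @: [set b : 'I_m.+1 | j < b < m.+1]| = m - j.
    by rewrite card_imset ?card_ord_itv //; apply: perm_inj.
  have -> : s i = #|[set v : 'I_m.+1 | 0 <= v < s i]| :> nat.
    by rewrite card_ord_itv ?subn0 // ltnW.
  apply/subset_leq_card/subsetP => _ /imsetP[b + ->].
  by rewrite !inE => /andP[/right].
have : #|s @: [set b : 'I_m.+1 | 0 <= b < j]|
    <= #|[set v : 'I_m.+1 | s i <= v < m]|.
  apply/subset_leq_card/subsetP => _ /imsetP[b + ->].
  rewrite !inE => /= ltb; rewrite left //=.
  by have := ord_perm_eqE m.+1 s b j; have := ltn_ord (s b); lia.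
rewrite (card_imset _ (@perm_inj _ s)) !card_ord_itv // ?(ltnW (ltn_ord j)) //.
by have := right k ltk; lia.
Qed.

Lemma splits_shading1_occ m (s : 'S_m.+1) (j : 'I_m.+1) :
  0 < j -> splits_at m s j -> exists i, mesh12_occ shading1 s i j.
Proof.
move=> j0 /splits_atP[sj left right].
(* The lower point is the minimum of the prefix, which is nonempty because it contains position
   0. *)
have [i ltij min_i] :=
  @arg_minnP _ (ord0 : 'I_m.+1) (fun k => k < j) (fun k => s k) j0.
exists i; apply/shading1_occP; split=> // [|k ltk]; first by rewrite sj.
exact: leq_trans (right k ltk) (left i ltij).
Qed.

Lemma shading1_count m (s : 'S_m.+1) :
  mesh12_count shading1 s = [exists j : 'I_m.+1, (0 < j) && splits_at m s j].
Proof.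
(* The maximum determines [j], and the minimum of the prefix then determines [i]. *)
have le1 : mesh12_count shading1 s <= 1.
  apply/card_le1_eqP => -[i j] [i' j']; rewrite !inE /=.
  move=> /shading1_occP[ltij sj left _] /shading1_occP[ltij' sj' left' _].
  have eqj : j = j' by apply/(@perm_inj _ s)/val_inj/succn_inj; rewrite sj sj'.
  rewrite -eqj in ltij' left' *; congr (_, _).
  by apply/(@perm_inj _ s)/val_inj/anti_leq; rewrite left ?left'.
case: existsP => [[j /andP[j0 spl]]|noj].
  have [i occ] := splits_shading1_occ _ _ _ j0 spl.
  apply/eqP; rewrite eqn_leq le1 card_gt0; apply/set0Pn.
  by exists (i, j); rewrite inE.
apply: eq_card0 => -[i j]; rewrite inE /=; apply/negP => occ.
apply: noj; exists j; rewrite (shading1_occ_splits _ _ _ _ occ) andbT.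
by have /shading1_occP[ltij _ _ _] := occ; apply: leq_ltn_trans ltij.
Qed.

Lemma card_splits_at m (j : 'I_m.+1) :
  #|[set s : 'S_m.+1 | splits_at m s j]| = j`! * (m - j)`!.
Proof.
have ltj := ltn_ord j.
have cA : #|[set k : 'I_m.+1 | 0 <= k < j]| = j.
  by rewrite card_ord_itv ?subn0 // ltnW.
rewrite card_perm_imset ?cA ?card_ord ?subSn //.
- by rewrite inE ltnn andbF.
- by rewrite inE ltnn andbF.
- by rewrite card_ord_itv //; lia.
Qed.

Lemma mesh12_dist_shading1 n :
  mesh12_dist shading1 n 1 = \sum_(0 <= i < n.-1) i`! * (n - i - 1)`!.
Proof.
case: n => [|m].
  rewrite big_nil; apply: eq_card0 => s; rewrite inE /mesh12_count.
  by rewrite eq_card0 // => -[[]].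
rewrite /mesh12_dist.
(* Sort the permutations by the position of the maximum. *)
pose top (s : 'S_m.+1) := (s^-1)%g ord_max.
rewrite -sum1_card (partition_big top (fun j : 'I_m.+1 => 0 < j)); last first.
  move=> s; rewrite inE shading1_count eqb1.
  move=> /existsP[j /andP[j0 /andP[_ /eqP sj]]].
  by rewrite /top -sj permK.
have -> : \sum_(j < m.+1 | 0 < j)
      \sum_(s in [set s | mesh12_count shading1 s == 1] | top s == j) 1
   = \sum_(j < m.+1 | 0 < j) j`! * (m - j)`!.
  apply: eq_bigr => j j0; rewrite -card_splits_at sum1dep_card.
  apply: eq_card => s; rewrite !inE shading1_count eqb1.
  apply/andP/idP => [[/existsP[k /andP[k0 spl]] /eqP <-]|spl].
    by have /andP[_ /eqP sk] := spl; rewrite /top -sk permK.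
  split; first by apply/existsP; exists j; rewrite j0.
  by have /andP[_ /eqP sk] := spl; rewrite /top -sk permK.
(* The term [j = 0] drops out, and the reversal substitutes [j = m - i], which swaps the two
   factorials. *)
rewrite big_mkcond big_ord_recl /= add0n big_mkord (reindex_inj rev_ord_inj) /=.
apply: eq_bigr => i _; have lti := ltn_ord i.
by rewrite mulnC /bump /=; congr (_`! * _`!); lia.
Qed.

(** * The generating polynomial *)

Local Open Scope ring_scope.

Theorem theorem3p5 :
  (forall R1 R2 : {set 'I_3 * 'I_3},
     R1 \in shadings -> R2 \in shadings -> equidistributed R1 R2) /\
  (forall R : {set 'I_3 * 'I_3}, R \in shadings ->
   forall n : nat, (1 <= n)%N ->
     \sum_(s : 'S_n) 'X^(mesh12_count R s) =
       (n`!)%:R - (\sum_(0 <= i < n.-1) i`! * (n - i - 1)`!)%N%:R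
       + 'X * (\sum_(0 <= i < n.-1) i`! * (n - i - 1)`!)%N%:R :> {poly int}).
Proof.
split=> [R1 R2 R1s R2s n k|R Rs n n_gt0].
  by rewrite (shadings_equidistributed _ R1s) (shadings_equidistributed _ R2s).
have dist := shadings_equidistributed R Rs n.
rewrite -(mesh12_dist_shading1 n) -dist.
(* Any count attained for [R] is also attained for [shading1], so the bound 1 carries over. *)
have count_le1 (s : 'S_n) : (mesh12_count R s <= 1)%N.
  case: n n_gt0 dist s => // m _ dist s.
  have /card_gt0P[t] : (0 < mesh12_dist shading1 m.+1 (mesh12_count R s))%N.
    by rewrite -dist; apply/card_gt0P; exists s; rewrite inE.
  by rewrite inE => /eqP <-; rewrite shading1_count leq_b1.
(* A count of 0 or 1 makes the power of ['X] affine in the indicator of 1, so the sum needs only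
   [n!] and [mesh12_dist R n 1]. *)
have XE (s : 'S_n) : 'X^(mesh12_count R s)
    = 1 + ('X - 1) * (mesh12_count R s == 1)%N%:R :> {poly int}.
  by case: mesh12_count (count_le1 s) => [|[|]] //= _;
    rewrite ?mulr0 ?addr0 ?expr1 ?mulr1 ?subrKC ?expr0.
rewrite (eq_bigr _ (fun s _ => XE s)) big_split /= sumr_const card_Sn.
rewrite -big_distrr -natr_sum /= -big_mkcond sum1dep_card /mesh12_dist.
by rewrite mulrBl mul1r -addrA [- _ + _]addrC.
Qed.
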